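(* Let $\mathcal{C}$ be a clutter with vertex set $X=\{x_1,\ldots,x_n\}$ and let $I=I(\mathcal{C})\subset R=K[x_1,\ldots,x_n]$ be its edge ideal. Then $\mathcal{C}$ has the max-flow min-cut property if and only if $I^i=I^{(i)}$ for all $i\ge 1$, where $I^{(i)}$ is the $i$th symbolic power of $I$.
   Context: $K$ is a field, $R=K[x_1,\ldots,x_n]$. A clutter $\mathcal{C}$ with vertex set $X=\{x_1,\ldots,x_n\}$ is a family of subsets $S_1,\ldots,S_q$ of $X$, called edges, none of which is included in another; here $q\ge 1$ and the edges are nonempty. Its incidence matrix $A$ is the $n\times q$ $\{0,1\}$-matrix whose $j$th column is the characteristic vector of $S_j$. Its edge ideal $I=I(\mathcal{C})$ is the square-free monomial ideal of $R$ (minimally) generated by the monomials $\prod_{x_i\in S_j}x_i$, $j=1,\ldots,q$. If $\mathfrak{p}_1,\ldots,\mathfrak{p}_s$ are the minimal primes of $I$, the $i$th symbolic power of $I$ is $I^{(i)}=\mathfrak{p}_1^i\cap\cdots\cap\mathfrak{p}_s^i$. $\mathbf{1}$ denotes an all-ones vector, $\langle\,,\,\rangle$ the usual inner product, and vector inequalities are componentwise. The clutter $\mathcal{C}$ has the max-flow min-cut property if both sides of the LP-duality equation $$\min\{\langle\alpha,x\rangle\mid x\ge 0;\ xA\ge\mathbf{1}\}=\max\{\langle y,\mathbf{1}\rangle\mid y\ge 0;\ Ay\le\alpha\}$$ have integral optimum solutions $x$ and $y$ for each non-negative integral vector $\alpha\in\mathbb{N}^n$. *)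

(* Defs.v *)
From mathcomp Require Export all_boot all_order all_algebra.
From mathcomp Require Export boolp classical_sets reals.
From mathcomp Require Export mpoly.

Set Implicit Arguments.
Unset Strict Implicit.
Unset Printing Implicit Defensive.

Import GRing.Theory Num.Theory.

Local Open Scope classical_set_scope.
Local Open Scope ring_scope.

Section Ideals.
Variable A : comNzRingType.

Definition ideal_gen (G : set A) : set A :=
  [set p | exists (m : nat) (c g : 'I_m -> A),
     (forall k, G (g k)) /\ p = \sum_(k < m) c k * g k].

Definition ideal_pow (I : set A) (i : nat) : set A :=
  ideal_gen [set p | exists f : 'I_i -> A,
     (forall k, I (f k)) /\ p = \prod_(k < i) f k].

(* idealr_closed includes the condition that the ideal is proper. *)
Definition prime_ideal (P : set A) : Prop :=
  idealr_closed (in_set P) /\ prime_idealr_closed (in_set P).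

Definition minimal_primes (I : set A) : set (set A) :=
  [set P | [/\ prime_ideal P, I `<=` P &
     forall Q, prime_ideal Q -> I `<=` Q -> Q `<=` P -> Q = P]].

Definition symbolic_pow (I : set A) (i : nat) : set A :=
  \bigcap_(P in minimal_primes I) ideal_pow P i.

End Ideals.

Section Clutters.
Variable n : nat.
Implicit Type C : {set {set 'I_n}}.

Definition clutter C : Prop :=
  [/\ (0 < #|C|)%N,
      forall S, S \in C -> S != finset.set0 &
      forall S T, S \in C -> T \in C -> S \subset T -> S = T].

Definition edge_ideal (K : fieldType) C : set {mpoly K[n]} :=
  ideal_gen [set p | exists2 S, S \in C & p = \prod_(i in S) 'X_i].

Definition incidence_mx (R : pzSemiRingType) C : 'M[R]_(n, #|C|) :=
  \matrix_(i, j) (i \in (enum_val j : {set 'I_n}))%:R.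

End Clutters.

Arguments edge_ideal {n} K C _.

Section LinearPrograms.
Variable R : realType.

Definition mx_le m n (u v : 'M[R]_(m, n)) : Prop :=
  forall i j, u i j <= v i j.

Definition inner m (u v : 'I_m -> R) : R := \sum_(i < m) u i * v i.

Variables (n q : nat) (A : 'M[R]_(n, q)) (alpha : 'cV[R]_n).

Definition primal_feasible (x : 'rV[R]_n) : Prop :=
  mx_le 0 x /\ mx_le (const_mx 1) (x *m A).

Definition dual_feasible (y : 'cV[R]_q) : Prop :=
  mx_le 0 y /\ mx_le (A *m y) alpha.

Definition primal_value (x : 'rV[R]_n) : R := inner (alpha^~ 0) (x 0).

Definition dual_value (y : 'cV[R]_q) : R := inner (y^~ 0) (fun=> 1).

Definition primal_optimum (x : 'rV[R]_n) : Prop :=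
  primal_feasible x /\
  forall x', primal_feasible x' -> primal_value x <= primal_value x'.

Definition dual_optimum (y : 'cV[R]_q) : Prop :=
  dual_feasible y /\
  forall y', dual_feasible y' -> dual_value y' <= dual_value y.

End LinearPrograms.

Definition max_flow_min_cut (R : realType) n (C : {set {set 'I_n}}) : Prop :=
  forall alpha : 'cV[nat]_n,
    let a : 'cV[R]_n := map_mx (fun k : nat => k%:R) alpha in
    let A := incidence_mx R C in
    (exists2 x, x \is a mxOver Num.int & primal_optimum A a x) /\
    (exists2 y, y \is a mxOver Num.int & dual_optimum A a y).

(* Main.v *)
(* A polynomial lies in [I^i] iff every exponent [m] of its support dominates a
   sum of [i] edges, and it lies in [I^(i)] iff every [m] has weight at least
   [i] on each minimal vertex cover.  Hence [I^i = I^(i)] for all [i] says that,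
   for every weight vector [m], the maximal integral packing of edges is as
   large as the minimal weight of a vertex cover.  Linear programming duality
   identifies this equality with the integrality of both optima. *)
Require Import Defs.

Set Implicit Arguments.
Unset Strict Implicit.
Unset Printing Implicit Defensive.

Import Order.TTheory GRing.Theory Num.Theory.

Local Open Scope classical_set_scope.
Local Open Scope ring_scope.

(** * Ideals *)

Section IdealLemmas.
Variable A : comNzRingType.
Implicit Types I J G : set A.

(** Properness is not demanded, so that the unit ideal, such as a zeroth power, qualifies. *)
Definition is_ideal J : Prop :=
  J 0 /\ forall a u v, J u -> J v -> J (a * u + v).

Lemma is_idealD J u v : is_ideal J -> J u -> J v -> J (u + v).
Proof. by move=> [_ hJ] Ju Jv; rewrite -[u]mul1r; apply: hJ. Qed.

Lemma is_idealM J a u : is_ideal J -> J u -> J (a * u).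
Proof. by move=> [J0 hJ] Ju; rewrite -[_ * _]addr0; apply: hJ. Qed.

Lemma is_ideal_sum J (T : Type) (r : seq T) (P : pred T) (F : T -> A) :
  is_ideal J -> (forall t, P t -> J (F t)) -> J (\sum_(t <- r | P t) F t).
Proof.
move=> hJ hF; apply: (big_ind J) => //; first by case: hJ.
by move=> x y; apply: is_idealD.
Qed.

Lemma ideal_gen_is_ideal G : is_ideal (ideal_gen G).
Proof.
split; first by exists 0%N, (fun=> 0), (fun=> 0); split; [case | rewrite big_ord0].
move=> a u v [m1 [c1 [g1 [h1 ->]]]] [m2 [c2 [g2 [h2 ->]]]].
exists (m1 + m2)%N.
exists (fun k => match split k with inl i => a * c1 i | inr j => c2 j end).
exists (fun k => match split k with inl i => g1 i | inr j => g2 j end).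
split; first by move=> k; case: (split k).
rewrite big_split_ord /= mulr_sumr; congr (_ + _); apply: eq_bigr => k _.
  by rewrite (unsplitK (inl k : 'I_m1 + 'I_m2)%type) mulrA.
by rewrite (unsplitK (inr k : 'I_m1 + 'I_m2)%type).
Qed.

Lemma sub_ideal_gen G : G `<=` ideal_gen G.
Proof.
move=> p Gp; exists 1%N, (fun=> 1), (fun=> p).
by split => //; rewrite big_ord1 mul1r.
Qed.

Lemma ideal_gen_sub G J : is_ideal J -> G `<=` J -> ideal_gen G `<=` J.
Proof.
move=> hJ GJ p [m [c [g [hg ->]]]].
by apply: is_ideal_sum => // k _; apply: is_idealM => //; apply: GJ.
Qed.

Lemma ideal_pow_sub I J i : I `<=` J -> ideal_pow I i `<=` ideal_pow J i.
Proof.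
move=> IJ; apply: ideal_gen_sub; first exact: ideal_gen_is_ideal.
move=> p [f [hf ->]]; apply: sub_ideal_gen; exists f; split=> // k.
exact: IJ.
Qed.

Lemma ideal_pow0 I a : ideal_pow I 0 a.
Proof.
rewrite -[a]mulr1; apply: is_idealM; first exact: ideal_gen_is_ideal.
by apply: sub_ideal_gen; exists (fun=> 0); split; [case | rewrite big_ord0].
Qed.

Lemma ideal_powS I i a b :
  I a -> ideal_pow I i b -> ideal_pow I i.+1 (a * b).
Proof.
move=> Ia [m [c [g [hg ->]]]]; rewrite mulr_sumr.
apply: is_ideal_sum; first exact: ideal_gen_is_ideal.
move=> k _; rewrite mulrCA; apply: is_idealM; first exact: ideal_gen_is_ideal.
have [f [hf ->]] := hg k; apply: sub_ideal_gen.
exists (fun l => if unlift ord0 l is Some l' then f l' else a); split.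
  by move=> l; case: unliftP.
rewrite big_ord_recl unlift_none; congr (_ * _).
by apply: eq_bigr => l _; rewrite liftK.
Qed.

Lemma prime_ideal_is_ideal P : prime_ideal P -> is_ideal P.
Proof.
move=> [[/asboolP P0 _ hP] _]; split=> // a u v Pu Pv.
by apply/asboolP/hP; apply/asboolP.
Qed.

Lemma prime_ideal_prod P (T : Type) (r : seq T) (Q : pred T) (F : T -> A) :
  prime_ideal P -> P (\prod_(t <- r | Q t) F t) -> exists2 t, Q t & P (F t).
Proof.
move=> [[_ P1 _] hP]; elim: r => [|t r IH].
  by rewrite big_nil => h; case/negP: P1; apply/asboolP.
rewrite big_cons; case: ifP => // Qt /asboolP /hP /orP[] /asboolP // h.
by exists t.
Qed.

End IdealLemmas.

(** * Monomial ideals *)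

Section MonomialIdeals.
Variables (K : fieldType) (n : nat).
Implicit Types (E : set 'X_{1..n}) (I J : set {mpoly K[n]}) (T : {set 'I_n}).

(** The span of the monomials with exponent in [E]; it is a monomial ideal once [E] is closed under
    adding exponents. *)
Definition supported_in E : set {mpoly K[n]} :=
  [set p | forall m, m \in msupp p -> E m].

Lemma supported_in_is_ideal E :
  (forall a b, E b -> E (a + b)%MM) -> is_ideal (supported_in E).
Proof.
move=> hE; split; first by move=> m; rewrite msupp0.
move=> a u v hu hv m /msuppD_le; rewrite mem_cat => /orP[|/hv//].
by move=> /msuppM_le /allpairsP[[m1 m2] /= [_ /hu h ->]]; apply: hE.
Qed.

Lemma is_ideal_mpoly J p :
  is_ideal J -> (forall m, m \in msupp p -> J 'X_[m]) -> J p.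
Proof.
move=> hJ hp; rewrite (mpolyE p) big_seq; apply: is_ideal_sum => // m /hp.
by rewrite -mul_mpolyC; apply: is_idealM.
Qed.

(** The exponents dominating a sum of [i] members of [E] are closed under adding exponents, so the
    polynomials supported there form an ideal. It remains to treat a product of [i] elements of
    [I]. *)
Lemma msupp_ideal_pow I E i p m :
  I `<=` supported_in E -> ideal_pow I i p -> m \in msupp p ->
  exists g : 'I_i -> 'X_{1..n},
    (forall k, E (g k)) /\ (\sum_(k < i) g k <= m)%MM.
Proof.
move=> IE [l [c [q [hq ->]]]].
set D := [set m' | exists g : 'I_i -> 'X_{1..n},
    (forall k, E (g k)) /\ (\sum_(k < i) g k <= m')%MM].
suff : supported_in D (\sum_(k < l) c k * q k) by apply.
have Did : is_ideal (supported_in D).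
  apply: supported_in_is_ideal => a b [g [gE gb]]; exists g; split=> //.
  exact: lepm_trans gb (lem_addl _ _).
apply: is_ideal_sum => // k _; apply: (@is_idealM _ (supported_in D)) => //.
have [f [hf ->]] := hq k.
(* For a bare product the domination is an equality: an exponent of the product is a sum of
   exponents, one from each factor. *)
move=> m' hm'; suff [g [gE ->]] : exists g : 'I_i -> 'X_{1..n},
    (forall k, E (g k)) /\ m' = (\sum_(k < i) g k)%MM.
  by exists g; split=> //; apply: lepm_refl.
elim: i f hf m' hm' {q hq D Did} => [|i IH] f hf m'.
  rewrite big_ord0 msupp1 inE => /eqP->; exists (fun=> 0%MM).
  by split; [case | rewrite big_ord0].
rewrite big_ord_recl => /msuppM_le /allpairsP[[m1 m2] /= [h1 h2 ->]].
have [g [gE ->]] := IH _ (fun k => hf (lift ord0 k)) _ h2.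
exists (fun l => if unlift ord0 l is Some l' then g l' else m1); split.
  by move=> j; case: unliftP => // _; apply: (IE _ (hf ord0)).
rewrite big_ord_recl unlift_none; congr (_ + _)%MM.
by apply: eq_bigr => j _; rewrite liftK.
Qed.

(** With [c] read as multiplicities, one factor ['X_[g j]] is split off ['X_[m]] at a time. This
    serves both for edges in the edge ideal and for variables in a prime. *)
Lemma mpolyX_ideal_pow I (J : finType) (g : J -> 'X_{1..n}) (c : J -> nat) i
    (m : 'X_{1..n}) :
  is_ideal I -> (forall j, (0 < c j)%N -> I 'X_[g j]) ->
  (i <= \sum_j c j)%N -> (forall v, (\sum_j c j * g j v <= m v)%N) ->
  ideal_pow I i 'X_[m].
Proof.
move=> hI; elim: i c m => [|i IH] c m hc hi hm; first exact: ideal_pow0.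
have [j cj] : exists j, (0 < c j)%N.
  apply/existsP; apply: contraLR hi; rewrite negb_exists => /forallP h.
  by rewrite big1 // => j _; apply/eqP; rewrite -leqn0 leqNgt.
(* One copy of [j] is removed; the truncated subtraction is exact because [c j] is positive. *)
pose c' k := (c k - (k == j))%N.
have cE k : c k = ((k == j) + c' k)%N.
  by rewrite /c' subnKC //; case: eqP => // ->.
have c'S : (\sum_k c k = (\sum_k c' k).+1)%N.
  rewrite (eq_bigr _ (fun k _ => cE k)) big_split /= -add1n; congr addn.
  by rewrite -big_mkcond big_pred1_eq.
have c'M v : (\sum_k c k * g k v = g j v + \sum_k c' k * g k v)%N.
  under eq_bigr => k _ do rewrite cE mulnDl.
  rewrite big_split /=; congr addn; rewrite (bigD1 j) //= eqxx mul1n.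
  by rewrite big1 ?addn0 // => k /negPf->.
have le_gm : (g j <= m)%MM.
  by apply/mnm_lepP => v; apply: leq_trans (hm v); rewrite c'M leq_addr.
rewrite -(submK le_gm) addmC mpolyXD; apply: ideal_powS; first exact: hc.
apply: (IH c').
- by move=> k hk; apply: hc; rewrite cE ltn_addl.
- by rewrite c'S ltnS in hi.
- by move=> v; rewrite mnmBE leq_subRL ?(mnm_lepP le_gm) // -c'M.
Qed.

(** The ideal generated by the variables in [T], described through exponents. *)
Definition var_ideal T : set {mpoly K[n]} :=
  supported_in [set m | exists2 v, v \in T & (0 < m v)%N].

Lemma var_ideal_is_ideal T : is_ideal (var_ideal T).
Proof.
apply: supported_in_is_ideal => a b [v vT bv]; exists v => //.
by rewrite mnmDE ltn_addl.
Qed.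

Lemma mem_var_ideal T v : var_ideal T 'X_v -> v \in T.
Proof.
move=> /(_ U_(v)%MM); rewrite msuppX inE eqxx => /(_ isT)[w wT].
by rewrite mnm1E; case: eqP => // ->.
Qed.

Lemma var_ideal_sub T J :
  is_ideal J -> (forall v, v \in T -> J 'X_v) -> var_ideal T `<=` J.
Proof.
move=> hJ hT p hp; apply: is_ideal_mpoly => // m /hp[v vT mv].
have /submK <- : (U_(v) <= m)%MM by rewrite lep1mP -lt0n.
by rewrite mpolyXD; apply: is_idealM => //; apply: hT.
Qed.

(* Its kernel is [var_ideal T], which is therefore prime. *)
Definition kill_vars T : {mpoly K[n]} -> {mpoly K[n]} :=
  mmap (@mpolyC n K) (fun v => if v \in T then 0 else 'X_v).

Lemma kill_varsM T : {morph kill_vars T : p q / p * q}.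
Proof. by move=> p q; apply: rmorphM. Qed.

(** By linearity a single monomial suffices: if it involves a variable of [T] it is killed and lies
    in the ideal, otherwise it is fixed. *)
Lemma kill_vars_sub T p : var_ideal T (p - kill_vars T p).
Proof.
have hT := var_ideal_is_ideal T.
have -> : kill_vars T p = \sum_(m <- msupp p) kill_vars T (p@_m *: 'X_[m]).
  by rewrite {1}[p]mpolyE; apply: raddf_sum.
rewrite {1}[p]mpolyE -sumrB; apply: is_ideal_sum => // m _.
rewrite /kill_vars mmapZ -mul_mpolyC -mulrBr.
apply: (@is_idealM _ (var_ideal T)) => //; rewrite mmapX /mmap1.
have [/existsP[v /andP[vT mv]]|] := boolP [exists v, (v \in T) && (0 < m v)%N].
  rewrite (bigD1 v) //= vT expr0n eqn0Ngt mv mul0r subr0.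
  by move=> m'; rewrite msuppX inE => /eqP ->; exists v.
rewrite negb_exists => /forallP h; rewrite mpolyXE_id.
rewrite [X in _ - X](eq_bigr (fun v => 'X_v ^+ m v)) ?subrr; first by case: hT.
move=> v _; case: ifP => // vT; have := h v; rewrite vT -eqn0Ngt => /eqP->.
by rewrite !expr0.
Qed.

Lemma kill_vars_eq0 T p : var_ideal T p -> kill_vars T p = 0.
Proof.
apply: (var_ideal_sub (J := [set p | kill_vars T p = 0])).
  split; first exact: raddf0.
  move=> a u v /= hu hv; rewrite /kill_vars rmorphD rmorphM /=.
  by rewrite -!/(kill_vars T _) hu hv mulr0 addr0.
by move=> v vT /=; rewrite /kill_vars mmapX mmap1U vT.
Qed.

Lemma var_ideal_prime T : prime_ideal (var_ideal T).
Proof.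
have hT := var_ideal_is_ideal T; split.
  split; first by apply/asboolP; case: hT.
    apply/negP => /asboolP /kill_vars_eq0; rewrite /kill_vars rmorph1.
    by move/eqP; rewrite oner_eq0.
  by move=> a u v /asboolP hu /asboolP hv; apply/asboolP; case: hT => _; apply.
move=> p q /asboolP /kill_vars_eq0; rewrite kill_varsM => /eqP.
rewrite mulf_eq0 => /orP[] /eqP h; apply/orP; [left|right]; apply/asboolP.
  by have := @kill_vars_sub T p; rewrite h subr0.
by have := @kill_vars_sub T q; rewrite h subr0.
Qed.

(** Each of the [i] exponents whose sum lies below [m] has weight at least one on [T]. *)
Lemma var_ideal_pow T i p m :
  ideal_pow (var_ideal T) i p -> m \in msupp p -> (i <= \sum_(v in T) m v)%N.
Proof.
move=> hp /(msupp_ideal_pow (@subset_refl _ _) hp)[g [hg /mnm_lepP le_gm]].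
apply: leq_trans (leq_sum _ (fun v _ => le_gm v)).
under eq_bigr => v _ do rewrite mnm_sumE.
rewrite exchange_big /= -[i in (i <= _)%N]card_ord -sum1_card leq_sum // => k _.
by have [v vT gv] := hg k; rewrite (bigD1 v) //= ltn_addr.
Qed.

End MonomialIdeals.

(** * Linear programming duality *)

Section Duality.
Variable R : realType.

(* Bartl's induction on the number of rows: when the row [g] is needed, a
   vector [d0] that violates the conclusion only because of [g] is used to
   eliminate [g] from the other rows and from [b]. *)
Lemma farkas m n (G : 'M[R]_(m, n)) (b : 'rV[R]_n) :
  (forall d : 'cV[R]_n, mx_le 0 (G *m d) -> 0 <= (b *m d) 0 0) ->
  exists2 y : 'rV[R]_m, mx_le 0 y & b = y *m G.
Proof.
elim: m G b => [|m IH] G b hb.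
  exists 0; first by move=> i j; rewrite mxE.
  have G0 (d : 'cV[R]_n) : mx_le 0 (G *m d) by case.
  rewrite mul0mx; apply/matrixP => i j; rewrite ord1 mxE; apply/le_anti.
  (* Without rows every vector is admissible, so [b] is nonnegative on each basis vector and on its
     opposite. *)
  have := hb (- delta_mx j 0) (G0 _); have := hb (delta_mx j 0) (G0 _).
  by rewrite mulmxN -colE !mxE oppr_ge0 => -> ->.
rewrite -[m.+1]/(1 + m)%N in G hb *.
set g := usubmx G; set G' := dsubmx G.
have GE : G = col_mx g G' by rewrite vsubmxK.
have le_col (d : 'cV[R]_n) : 0 <= (g *m d) 0 0 -> mx_le 0 (G' *m d) -> 0 <= (b *m d) 0 0.
  move=> gd G'd; apply: (hb d); rewrite GE mul_col_mx => i j.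
  rewrite mxE [X in _ <= X]mxE; case: (split i) => k; rewrite ?ord1 //.
  by have := G'd k 0; rewrite mxE.
have [h|/existsNP[d0 /not_implyP[G'd0 /negP]]] := pselect
    (forall d : 'cV[R]_n, mx_le 0 (G' *m d) -> 0 <= (b *m d) 0 0).
  have [y y0 ->] := IH _ _ h; exists (row_mx 0 y).
    move=> i j; rewrite mxE [X in _ <= X]mxE; case: (split j) => k.
      by rewrite mxE.
    by have := y0 i k; rewrite mxE.
  by rewrite GE mul_row_col mul0mx add0r.
rewrite -ltNge => bd0.
have gd0 : (g *m d0) 0 0 < 0.
  by rewrite ltNge; apply: contraTN bd0 => h; rewrite -leNgt; apply: le_col.
(* With this scaling, [d + c d0 (g d)] is the projection of [d] onto the kernel of [g] along [d0];
   [elim] composes a matrix with that projection. *)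
set c := - ((g *m d0) 0 0)^-1.
have c_gt0 : 0 < c by rewrite oppr_gt0 invr_lt0.
pose elim p (H : 'M[R]_(p, n)) := H + c *: (H *m d0 *m g).
have elimE p (H : 'M[R]_(p, n)) d :
    elim p H *m d = H *m (d + c *: (d0 *m (g *m d))).
  by rewrite mulmxDl mulmxDr -scalemxAl -scalemxAr !mulmxA.
have [d|y y0 yE] := IH (elim _ G') (elim _ b).
  rewrite !elimE; apply: le_col; rewrite mulmxDr -scalemxAr (mulmxA g).
  rewrite [g *m d0]mx11_scalar mul_scalar_mx scalerA mulNr mulVf ?lt_eqF //.
  by rewrite scaleN1r subrr mxE.
have G'y : 0 <= (y *m (G' *m d0)) 0 0.
  rewrite mxE sumr_ge0 // => k _; apply: mulr_ge0.
    by have := y0 0 k; rewrite mxE.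
  by have := G'd0 k 0; rewrite mxE.
(* The multiplier of [g] comes from solving [elim b = y (elim G')] for [b]; it is nonnegative since
   [y G' d0 >= 0] and [b d0 < 0]. *)
exists (row_mx (c *: (y *m (G' *m d0) - b *m d0)) y).
  move=> i j; rewrite mxE [X in _ <= X]mxE; case: (split j) => k.
    rewrite !ord1 [X in _ <= X]mxE pmulr_rge0 //.
    by rewrite mxE [X in _ + X]mxE addr_ge0 // oppr_ge0 ltW.
  by have := y0 i k; rewrite mxE.
move: yE; rewrite GE mul_row_col /elim mulmxDr -scalemxAr => /esym/eqP.
rewrite -subr_eq => /eqP bE; rewrite -[LHS]bE.
by rewrite -scalemxAl mulmxBl scalerBr !mulmxA [RHS]addrC addrA.
Qed.

Variables (n q : nat) (A : 'M[R]_(n, q)) (alpha : 'cV[R]_n).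

(** Both values are compared with [x A y]. *)
Lemma weak_duality x y :
  primal_feasible A x -> dual_feasible A alpha y ->
  dual_value y <= primal_value alpha x.
Proof.
move=> [x0 xA] [y0 Ay].
have yE : dual_value y <= (x *m A *m y) 0 0.
  rewrite mxE /dual_value /inner; apply: ler_sum => j _.
  rewrite mulr1 ler_peMl //; first by have := y0 j 0; rewrite mxE.
  by have := xA 0 j; rewrite mxE.
apply: (le_trans yE); rewrite -mulmxA mxE; apply: ler_sum => i _.
rewrite mulrC ler_wpM2r //.
by have := x0 0 i; rewrite mxE.
Qed.

(* Farkas' lemma applied to the homogenization of the primal program: the rows
   are the constraints [x A >= t 1], [x >= 0] and [t >= 0]. *)
Lemma strong_duality v :
  mx_le 0 alpha ->
  (forall x, primal_feasible A x -> v <= primal_value alpha x) ->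
  exists2 y, dual_feasible A alpha y & v <= dual_value y.
Proof.
move=> alpha0 hv.
pose G : 'M[R]_(q + (n + 1), n + 1) :=
  col_mx (row_mx A^T (const_mx (- 1))) 1%:M.
(* The functional to be represented is [alpha u - v t], where [t] is the homogenizing coordinate. *)
have [d|z z0] := @farkas _ _ G (row_mx alpha^T (const_mx (- v))).
  rewrite -[d]vsubmxK; move: (usubmx d) (dsubmx d) => u t hd.
  have AuE j : t 0 0 <= (u^T *m A) 0 j.
    rewrite -[A]trmxK -trmx_mul mxE.
    have := hd (lshift _ j) 0; rewrite /G mul_col_mx col_mxEu mul_row_col.
    rewrite [t]mx11_scalar mul_mx_scalar; move: (A^T *m u) => B.
    by rewrite !mxE mulrN1 subr_ge0.
  have u0 i : 0 <= u i 0.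
    have := hd (rshift _ (lshift _ i)) 0.
    by rewrite /G mul_col_mx col_mxEd mul1mx col_mxEu mxE.
  have t0 : 0 <= t 0 0.
    have := hd (rshift _ (rshift _ 0)) 0.
    by rewrite /G mul_col_mx col_mxEd mul1mx col_mxEd mxE.
  have bE : (row_mx alpha^T (const_mx (- v)) *m col_mx u t) 0 0 =
      inner (alpha^~ 0) (u^~ 0) - v * t 0 0.
    rewrite mul_row_col mxE [X in _ + X]mxE big_ord1 [const_mx _ _ _]mxE mulNr; congr (_ - _).
    by rewrite mxE; apply: eq_bigr => i _; rewrite mxE.
  (* For positive [t] the point [u / t] is feasible and [hv] applies; for [t = 0] the signs of
     [alpha] and [u] suffice. *)
  rewrite bE subr_ge0; have [t_gt0|t_le0] := ltP 0 (t 0 0); last first.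
    have -> : t 0 0 = 0 by apply/le_anti; rewrite t_le0 t0.
    rewrite mulr0 sumr_ge0 // => i _; rewrite mulr_ge0 //.
    by have := alpha0 i 0; rewrite mxE.
  rewrite -ler_pdivlMr //; apply: le_trans (hv ((t 0 0)^-1 *: u^T) _) _.
    split=> i j.
      by rewrite ord1 !mxE mulr_ge0 ?invr_ge0.
    rewrite ord1 -scalemxAl mxE [X in _ <= X]mxE mulrC ler_pdivlMr // mul1r.
    exact: AuE.
  rewrite /primal_value /inner mulr_suml ler_sum // => i _.
  by rewrite !mxE mulrCA mulrC.
(* The multipliers split into the dual solution [y] and slacks [s]: the first [n] coordinates give
   [alpha = A y + s], the last one says that the sum of [y] exceeds [v] by the last slack. *)
rewrite -[z]hsubmxK in z0 *; move: (lsubmx z) (rsubmx z) z0 => y s z0.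
have y0 j : 0 <= y 0 j by have := z0 0 (lshift _ j); rewrite row_mxEl mxE.
have s0 k : 0 <= s 0 k by have := z0 0 (rshift _ k); rewrite row_mxEr mxE.
rewrite mul_row_col mul_mx_row mulmx1 => /rowP zE.
exists y^T.
  split=> [i j|i j]; first by rewrite !mxE ord1.
  have := zE (lshift _ i); rewrite ord1 row_mxEl [X in _ = X]mxE row_mxEl mxE => ->.
  by rewrite -[A]trmxK -trmx_mul trmxK mxE lerDl.
have := zE (rshift _ 0); rewrite row_mxEr [X in _ = X]mxE row_mxEr !mxE.
move=> /(congr1 -%R); rewrite opprK opprD => ->.
rewrite -sumrN lerBlDr ler_wpDr // ler_sum // => j _.
by rewrite !mxE mulrN opprK.
Qed.

End Duality.

(** * Edge ideals and vertex covers *)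

Section EdgeIdeals.
Variables (K : fieldType) (n : nat) (C : {set {set 'I_n}}).
Implicit Types (S T : {set 'I_n}) (P : set {mpoly K[n]}).

Definition edge_mnm S : 'X_{1..n} := [multinom nat_of_bool (v \in S) | v < n].

Lemma mpolyX_edge S : 'X_[edge_mnm S] = \prod_(v in S) 'X_v :> {mpoly K[n]}.
Proof.
rewrite mpolyXE_id [RHS]big_mkcond; apply: eq_bigr => v _.
by rewrite mnmE; case: (v \in S).
Qed.

Definition vertex_cover T : bool := [forall S in C, [exists v in S, v \in T]].

Lemma vertex_coverP T :
  reflect (forall S, S \in C -> exists2 v, v \in S & v \in T) (vertex_cover T).
Proof.
apply: (iffP forall_inP) => h S /h; first by case/exists_inP => v; exists v.
by move=> hv; apply/exists_inP.
Qed.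

Lemma edge_ideal_supported :
  edge_ideal K C `<=`
    supported_in [set m | exists2 S, S \in C & (edge_mnm S <= m)%MM].
Proof.
apply: ideal_gen_sub.
  apply: supported_in_is_ideal => a b [S SC Sb]; exists S => //.
  exact: lepm_trans Sb (lem_addl _ _).
move=> p [S SC ->] m; rewrite -mpolyX_edge msuppX inE => /eqP->.
by exists S => //; apply: lepm_refl.
Qed.

Lemma edge_ideal_sub_var_ideal T :
  vertex_cover T -> edge_ideal K C `<=` var_ideal T.
Proof.
move=> /vertex_coverP hT p /edge_ideal_supported hp m /hp[S /hT[v vS vT]].
by move=> /mnm_lepP/(_ v); rewrite mnmE vS; exists v.
Qed.

(** The prime contains each edge monomial, hence one of its variables. *)
Lemma prime_ideal_vertex_cover P :
  prime_ideal P -> edge_ideal K C `<=` P ->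
  vertex_cover [set v | `[< P 'X_v >]].
Proof.
move=> hP IP; apply/vertex_coverP => S SC.
have /(prime_ideal_prod hP)[v vS Pv] : P (\prod_(v in S) 'X_v).
  by apply/IP/sub_ideal_gen; exists S.
by exists v => //; rewrite finset.inE; apply/asboolP.
Qed.

(** The variables in a prime [Q] between the edge ideal and [var_ideal T] form a cover inside [T];
    by minimality it is [T], so [Q] contains all the generators. *)
Lemma minimal_primes_var_ideal T :
  minset vertex_cover T -> minimal_primes (edge_ideal K C) (var_ideal T).
Proof.
move=> /minsetP[hT minT]; split.
- exact: var_ideal_prime.
- exact: edge_ideal_sub_var_ideal.
move=> Q hQ IQ QT; apply/seteqP; split=> //; apply: var_ideal_sub.
  exact: prime_ideal_is_ideal.
move=> v; rewrite -(minT _ (prime_ideal_vertex_cover hQ IQ)).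
  by rewrite finset.inE => /asboolP.
apply/fintype.subsetP => w; rewrite finset.inE => /asboolP /QT.
exact: mem_var_ideal.
Qed.

Lemma ideal_pow_edge_ideal_sub_symbolic i :
  ideal_pow (edge_ideal K C) i `<=` symbolic_pow (edge_ideal K C) i.
Proof. by move=> p hp P [_ IP _]; apply: ideal_pow_sub hp. Qed.

Lemma symbolic_pow_edge_ideal_cover T i p m :
  minset vertex_cover T -> symbolic_pow (edge_ideal K C) i p ->
  m \in msupp p -> (i <= \sum_(v in T) m v)%N.
Proof.
by move=> hT hp; apply: var_ideal_pow; apply: hp; apply: minimal_primes_var_ideal.
Qed.

(** No classification of the minimal primes is required: the variables in such a prime form a cover,
    on which [m] has weight at least [i], so ['X_[m]] is a multiple of a product of [i] of them. *)
Lemma mpolyX_symbolic_pow_edge_ideal i (m : 'X_{1..n}) :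
  (forall T, vertex_cover T -> (i <= \sum_(v in T) m v)%N) ->
  symbolic_pow (edge_ideal K C) i 'X_[m].
Proof.
move=> hm P [hP IP _].
set T : {set 'I_n} := [set v | `[< P 'X_v >]]%SET.
have /hm hT : vertex_cover T by apply: prime_ideal_vertex_cover.
apply: (@mpolyX_ideal_pow _ _ _ _ (fun v => U_(v)%MM)
          (fun v => if v \in T then m v else 0%N)).
- exact: prime_ideal_is_ideal.
- by move=> v; case: ifP => //; rewrite finset.inE => /asboolP.
- by rewrite -big_mkcond.
move=> v; rewrite (bigD1 v) //= mnm1E eqxx muln1 big1 ?addn0.
  by case: ifP.
by move=> w /negPf; rewrite mnm1E => ->; rewrite muln0.
Qed.

Lemma mpolyX_ideal_pow_edge_ideal i (m : 'X_{1..n}) (c : 'I_#|C| -> nat) :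
  (i <= \sum_j c j)%N ->
  (forall v, \sum_j c j * (v \in (enum_val j : {set 'I_n})) <= m v)%N ->
  ideal_pow (edge_ideal K C) i 'X_[m].
Proof.
move=> hi hm; apply: (mpolyX_ideal_pow (g := fun j => edge_mnm (enum_val j)) (c := c)).
- exact: ideal_gen_is_ideal.
- move=> j _; rewrite mpolyX_edge; apply: sub_ideal_gen.
  by exists (enum_val j) => //; apply: enum_valP.
- exact: hi.
by move=> v; under eq_bigr => j _ do rewrite mnmE; exact: hm.
Qed.

Lemma ideal_pow_edge_ideal_packing i (m : 'X_{1..n}) :
  ideal_pow (edge_ideal K C) i 'X_[m] ->
  exists2 c : 'I_#|C| -> nat, (\sum_j c j = i)%N &
    forall v, (\sum_j c j * (v \in (enum_val j : {set 'I_n})) <= m v)%N.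
Proof.
move=> hI; have mm : m \in msupp ('X_[m] : {mpoly K[n]}) by rewrite msuppX inE.
have [g [gE gm]] := msupp_ideal_pow edge_ideal_supported hI mm.
have /choice[e he] : forall k, exists j : 'I_#|C|, (edge_mnm (enum_val j) <= g k)%MM.
  move=> k; have [S SC le_Sg] := gE k.
  by exists (enum_rank_in SC S); rewrite enum_rankK_in.
(* The multiplicity of an edge counts the factors for which it was chosen. *)
exists (fun j => \sum_(k < i) (e k == j))%N.
  rewrite exchange_big /=; transitivity (\sum_(k < i) 1)%N.
    apply: eq_bigr => k _.
    rewrite (bigD1 (e k)) //= eqxx big1 ?addn0 // => j /negPf.
    by rewrite eq_sym => ->.
  by rewrite sum1_card card_ord.
move=> v; apply: leq_trans (mnm_lepP gm v).
rewrite mnm_sumE; under eq_bigr => j _ do rewrite big_distrl /=.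
rewrite exchange_big /= leq_sum // => k _.
rewrite (bigD1 (e k)) //= eqxx mul1n big1 ?addn0.
  by have /mnm_lepP/(_ v) := he k; rewrite mnmE.
by move=> j /negPf; rewrite eq_sym => ->.
Qed.

End EdgeIdeals.

(** * Integral covers and packings in the linear programs *)

Section MaxFlowMinCut.
Variables (R : realType) (n : nat) (C : {set {set 'I_n}}).
Let A := incidence_mx R C.
Implicit Type T : {set 'I_n}.

(** An edge missing the support would have column sum zero, which is less than one. *)
Lemma vertex_cover_support (x : 'rV[R]_n) :
  mx_le (const_mx 1) (x *m A) -> vertex_cover C [set v | x 0 v != 0].
Proof.
move=> hx; apply/vertex_coverP => S SC.
have := hx 0 (enum_rank_in SC S); rewrite !mxE => h.
apply/exists_inP; apply: contraTT h => /exists_inPn hS.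
rewrite big1 ?ler10 // => v _; rewrite mxE enum_rankK_in //.
case vS: (v \in S); last by rewrite mulr0.
by have := hS v vS; rewrite finset.inE negbK => /eqP ->; rewrite mul0r.
Qed.

Lemma primal_feasible_vertex_cover T :
  vertex_cover C T -> primal_feasible A (\row_v (v \in T)%:R).
Proof.
move=> /vertex_coverP hT; split=> i j; first by rewrite !mxE ler0n.
have [v vS vT] := hT _ (enum_valP j).
rewrite !mxE (bigD1 v) //= !mxE vS vT mulr1 lerDl sumr_ge0 // => w _.
by rewrite !mxE mulr_ge0 ?ler0n.
Qed.

Lemma primal_value_vertex_cover (m : 'I_n -> nat) T :
  primal_value (\col_v (m v)%:R) (\row_v (v \in T)%:R) =
  (\sum_(v in T) m v)%:R :> R.
Proof.
rewrite natr_sum [RHS]big_mkcond; apply: eq_bigr => v _; rewrite !mxE.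
by case: (v \in T); rewrite ?mulr1 ?mulr0.
Qed.

Lemma dual_feasible_nat (m : 'I_n -> nat) (c : 'I_#|C| -> nat) :
  dual_feasible A (\col_v (m v)%:R) (\col_j (c j)%:R) <->
  forall v, (\sum_j c j * (v \in (enum_val j : {set 'I_n})) <= m v)%N.
Proof.
have AcE v : (A *m \col_j (c j)%:R) v 0 =
    (\sum_j c j * (v \in (enum_val j : {set 'I_n})))%:R.
  rewrite mxE natr_sum; apply: eq_bigr => j _.
  by rewrite !mxE natrM mulrC.
split=> [[_ h] v|h]; first by have := h v 0; rewrite AcE mxE ler_nat.
split=> i j; first by rewrite !mxE ler0n.
by rewrite ord1 AcE mxE ler_nat.
Qed.

Lemma dual_value_nat q (c : 'I_q -> nat) :
  dual_value (\col_j (c j)%:R) = (\sum_j c j)%:R :> R.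
Proof. by rewrite natr_sum; apply: eq_bigr => j _; rewrite mxE mulr1. Qed.

(* Rounding an integral cover [x] down to a minimal vertex cover inside its
   support bounds the minimum from below, and LP duality transfers the bound
   to the integral packing. *)
Lemma max_flow_min_cut_packing i (m : 'I_n -> nat) :
  max_flow_min_cut R C ->
  (forall T, minset (vertex_cover C) T -> (i <= \sum_(v in T) m v)%N) ->
  exists2 c : 'I_#|C| -> nat, (i <= \sum_j c j)%N &
    forall v, (\sum_j c j * (v \in (enum_val j : {set 'I_n})) <= m v)%N.
Proof.
move=> /(_ (\col_v m v)) /=; set a := map_mx _ _.
have aE : a = \col_v (m v)%:R by apply/matrixP => v j; rewrite !mxE.
rewrite {}aE => -[[x /mxOverP xint [[x0 xA] xopt]]].
move=> [y /mxOverP yint [yfeas yopt]] hm.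
have i_le_x : i%:R <= primal_value (\col_v (m v)%:R) x.
  have [T minT /fintype.subsetP subT] := minset_exists (vertex_cover_support xA).
  have := hm T minT; rewrite -(ler_nat R) => /le_trans; apply.
  rewrite natr_sum [leLHS]big_mkcond; apply: ler_sum => v _ /=; rewrite mxE.
  have xv0 : 0 <= x 0 v by have := x0 0 v; rewrite mxE.
  case: ifP => [/subT|_]; last by rewrite mulr_ge0 ?ler0n.
  rewrite finset.inE => xv; rewrite ler_peMr ?ler0n //.
  by rewrite -[x 0 v]ger0_norm // norm_intr_ge1.
have [|y' y'feas y'ge] := @strong_duality _ _ _ A (\col_v (m v)%:R) i%:R _
    (fun x' hx' => le_trans i_le_x (xopt x' hx')).
  by move=> v j; rewrite !mxE ler0n.
(* Being integral and nonnegative, the entries of [y] are natural numbers, which truncation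
   recovers. *)
have yE : y = \col_j (Num.truncn (y j 0))%:R.
  apply/matrixP => j k; rewrite mxE !ord1 truncnK // natrEint yint /=.
  by case: yfeas => + _ => /(_ j 0); rewrite mxE.
exists (fun j => Num.truncn (y j 0)).
  by rewrite -(ler_nat R) -dual_value_nat -yE (le_trans y'ge) // yopt.
by apply/dual_feasible_nat; rewrite -yE.
Qed.

(** A cover of least weight and a packing of that size are integral feasible solutions of equal
    value, so weak duality makes both optimal. The first hypothesis provides a cover, so that a
    least weight exists. *)
Lemma packing_max_flow_min_cut :
  vertex_cover C [set: 'I_n] ->
  (forall i (m : 'I_n -> nat),
    (forall T, vertex_cover C T -> (i <= \sum_(v in T) m v)%N) ->
    exists2 c : 'I_#|C| -> nat, (\sum_j c j = i)%N &
      forall v, (\sum_j c j * (v \in (enum_val j : {set 'I_n})) <= m v)%N) ->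
  max_flow_min_cut R C.
Proof.
move=> coverT hpack alpha /=; set a := map_mx _ _.
pose m v := alpha v 0.
have -> : a = \col_v (m v)%:R by apply/matrixP => v j; rewrite !mxE ord1.
case: (arg_minnP (fun T : {set 'I_n} => (\sum_(v in T) m v)%N) coverT).
move=> T hT minT; have [c cS cm] := hpack _ m minT.
have xfeas := primal_feasible_vertex_cover hT.
have /dual_feasible_nat yfeas := cm.
have valE : dual_value (\col_j (c j)%:R : 'cV[R]__) =
    primal_value (\col_v (m v)%:R) (\row_v (v \in T)%:R).
  by rewrite dual_value_nat primal_value_vertex_cover cS.
split.
  exists (\row_v (v \in T)%:R); first by apply/mxOverP => i j; rewrite mxE rpred_nat.
  by split=> // x' hx'; rewrite -valE; apply: weak_duality hx' yfeas.
exists (\col_j (c j)%:R); first by apply/mxOverP => i j; rewrite mxE rpred_nat.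
by split=> // y' hy'; rewrite valE; apply: weak_duality xfeas hy'.
Qed.

End MaxFlowMinCut.

Theorem corollary3p14 (R : realType) (K : fieldType) (n : nat)
    (C : {set {set 'I_n}}) (hC : clutter C) :
  max_flow_min_cut R C <->
  forall i : nat, (1 <= i)%N ->
    ideal_pow (edge_ideal K C) i = symbolic_pow (edge_ideal K C) i.
Proof.
split=> [hmfmc i _|hpow].
  apply/seteqP; split; first exact: ideal_pow_edge_ideal_sub_symbolic.
  move=> p hp; apply: is_ideal_mpoly; first exact: ideal_gen_is_ideal.
  move=> m mp; have [T hT|c ci cm] := max_flow_min_cut_packing (i := i) (m := m) hmfmc.
    exact: symbolic_pow_edge_ideal_cover hT hp mp.
  exact: mpolyX_ideal_pow_edge_ideal ci cm.
apply: packing_max_flow_min_cut.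
  apply/vertex_coverP => S; case: hC => _ hne _ /hne /set0Pn[v vS].
  by exists v; rewrite ?finset.inE.
move=> i m hm; pose mu : 'X_{1..n} := [multinom m v | v < n].
have [c ci cm] : exists2 c : 'I_#|C| -> nat, (\sum_j c j = i)%N &
    forall v, (\sum_j c j * (v \in (enum_val j : {set 'I_n})) <= mu v)%N.
  (* The equality of powers is assumed from exponent one on; the zeroth power is the whole ring. *)
  apply: (@ideal_pow_edge_ideal_packing K); case: (posnP i) => [->|i_gt0].
    exact: ideal_pow0.
  rewrite hpow //; apply: mpolyX_symbolic_pow_edge_ideal => T /hm.
  by under [X in _ -> (_ <= X)%N]eq_bigr => v _ do rewrite mnmE.
by exists c => // v; have := cm v; rewrite mnmE.
Qed.
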